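(* Let $G'$ be a set of real numbers greater than $1$ such that $\sum_{g\in G'} 1/\sqrt{g} < \infty$. Let $b_0'=1\le b_1'\le b_2'\le\dots$ be the Beurling integers generated by $G'$, and assume that there is $\delta>0$ with $b_{i+1}'-b_i' \ge \delta$ for all $i$. Then there exist numbers $\alpha\in\mathbb{R}\setminus\mathbb{Z}$, $\alpha>1$, such that for $G = G'\cup\{\alpha\}$ the Beurling integers $b_0=1\le b_1\le\dots$ generated by $G$ satisfy $b_{i+1}-b_i\ge\delta$ for all $i$. Moreover, the set of such numbers $\alpha$ has positive Lebesgue measure.
   Context: For a sequence $G=\{g_1,g_2,\dots\}$ of real numbers with $1<g_1\le g_2\le\dots$ (the generators), the associated Beurling integers are the sequence $B=\{b_0,b_1,b_2,\dots\}$, $b_0=1\le b_1\le b_2\le\dots$, consisting of all finite products of elements of $G$ (repetitions of factors allowed, the empty product being $1$), listed in nondecreasing order with multiplicity. *)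

(* Defs.v *)
From HB Require Import structures.
From mathcomp Require Import all_boot all_order all_algebra.
From mathcomp Require Import finmap multiset.
From mathcomp Require Import all_classical all_reals all_analysis.

Set Implicit Arguments.
Unset Strict Implicit.
Unset Printing Implicit Defensive.

Import Order.TTheory GRing.Theory Num.Theory.
Import numFieldNormedType.Exports.

Local Open Scope classical_set_scope.
Local Open Scope ring_scope.

(* A formal finite product of elements of G is a finite multiset, so that
   distinct multisets with the same value count separately. *)
Definition formal_products (R : realType) (G : set R) : set (multiset R) :=
  [set m : multiset R | forall g : R, g \in m -> G g].

(* [I] is the set of indices of the list: an initial segment of nat, which is
   all of nat if G is nonempty and {0} if G is empty (the only product is then
   the empty one). The values of [b] outside [I] are irrelevant. *)
Definition beurling_integers (R : realType) (G : set R) (I : set nat)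
    (b : nat -> R) : Prop :=
  [/\ forall i j : nat, (i <= j)%N -> I j -> I i,
      forall i j : nat, I i -> I j -> (i <= j)%N -> b i <= b j
    & exists e : nat -> multiset R,
        set_bij I (formal_products G) e /\
        forall i : nat, I i -> b i = \prod_(g <- e i) g].

(* Main.v *)
Require Import Defs.
From HB Require Import structures.
From mathcomp Require Import all_boot all_order all_algebra.
From mathcomp Require Import finmap multiset.
From mathcomp Require Import all_classical all_reals all_analysis.
From mathcomp Require Import ring lra.

Set Implicit Arguments.
Unset Strict Implicit.
Unset Printing Implicit Defensive.

Import Order.TTheory GRing.Theory Num.Theory.
Import numFieldNormedType.Exports.

Local Open Scope classical_set_scope.
Local Open Scope ring_scope.

(* Put B' for the set of products of G'. When alpha > 1 is not in G', every
   product over G' `|` [set alpha] is uniquely alpha ^+ k * b with b in B', and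
   dividing by the smaller power of alpha shows that these are delta-separated
   as soon as |alpha ^+ m * b - c| >= delta for all m >= 1 and b, c in B'. For
   fixed (m, b, c), the alpha in [X, 2X] violating this lie in an interval of
   length O(delta X / c) and force c >= X ^+ m * b / 4, so their measure is
   O(delta X * X^(-m/2) * b^(-1/2) * c^(-1/2)). The Euler product
   \sum_b b^(-1/2) = \prod_g (1 - g^(-1/2))^-1 is finite, so the violating
   alpha in [X, 2X] have total measure O(sqrt X), less than X for X large. The
   integers and G' are countable, hence negligible. *)

(** * Finite Euler products indexed by multisets *)

Section MultisetProducts.
Context {R : realFieldType} {T : choiceType}.
Implicit Types (f : T -> R) (A B M : multiset T) (g : T).

Lemma prod_msetD f A B :
  \prod_(g <- (A `+` B)%mset) f g = (\prod_(g <- A) f g) * \prod_(g <- B) f g.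
Proof.
rewrite -big_cat; apply: perm_big; apply/allP => a _ /=.
by rewrite count_cat !count_mem_mset msetE2.
Qed.

Lemma prod_mset_nat f n g : \prod_(h <- msetn n g) f h = f g ^+ n.
Proof.
rewrite enum_msetn big_nseq -Monoid.iteropE.
by elim: n => // n IHn; rewrite exprS -IHn.
Qed.

Lemma prod_msetB1 f M g : g \in M ->
  \prod_(h <- M) f h = f g * \prod_(h <- (M `\ g)%mset) f h.
Proof.
move=> gM; have {1}-> : M = ([mset g] `+` (M `\ g))%mset.
  apply/msetP => h; rewrite mset1DE msetB1E.
  case: eqP => [->|_]; last by rewrite subn0.
  by rewrite subnKC // mset_gt0.
by rewrite prod_msetD prod_mset_nat expr1.
Qed.

(** Expanding each [(1 - f g)^-1] as a geometric series produces every multiset supported on [s],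
    with nonnegative terms. Finite families avoid infinite series: the induction is on [s] and,
    inside it, on a bound [n] for the multiplicity of the head of [s]. *)
Lemma sum_prod_mset_le f (s : seq T) (F : seq (multiset T)) :
  {in s, forall g, 0 <= f g < 1} -> uniq F ->
  (forall M, M \in F -> forall g, g \in M -> g \in s) ->
  \sum_(M <- F) \prod_(g <- M) f g <= \prod_(g <- s) (1 - f g)^-1.
Proof.
elim: s F => [|g s IHs] F f01 uF sF.
  have F0 : {subset F <= [:: mset0]}.
    move=> M /sF M0; rewrite inE; apply/eqP/msetP => h.
    by rewrite mset0E; apply/eqP; rewrite mset_eq0; apply/negP => /M0.
  rewrite big_nil; have := uniq_leq_size uF F0.
  case: F F0 {uF sF} => [|M [|//]] F0 _; first by rewrite big_nil.
  rewrite big_seq1 (eqP (_ : M == mset0)) ?big_mset0 //.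
  by rewrite -mem_seq1 F0 ?mem_head.
rewrite big_cons; set P := \prod_(j <- s) _ in IHs *.
have f01s : {in s, forall h, 0 <= f h < 1}.
  by move=> h hs; apply: f01; rewrite inE hs orbT.
have P0 : 0 <= P.
  rewrite /P big_seq; apply: prodr_ge0 => h /f01s/andP[_ h1].
  by rewrite invr_ge0 subr_ge0 ltW.
have /andP[f0 f1] := f01 g (mem_head g s).
have [n hn] : exists n, forall M, M \in F -> (M g <= n)%N.
  exists (\max_(M <- F) M g)%N => M MF.
  by apply: (@leq_bigmax_seq _ F xpredT (fun M : multiset T => M g)).
elim: n F uF sF hn => [|n IHn] F uF sF hn.
  apply: (@le_trans _ _ P); last by rewrite ler_peMl // invf_ge1; lra.
  apply: IHs => // M MF h hM; have := sF M MF h hM.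
  rewrite inE => /orP[/eqP hg|//].
  by move: (hn _ MF); rewrite -hg leqn0 mset_eq0 hM.
(* Multisets without [g] fall to the induction on [s]. From the others one copy of [g] is removed,
   which is injective and lowers the multiplicity bound. *)
rewrite (bigID (fun M => g \in M)) /= -big_filter -[X in _ + X]big_filter.
set F1 := seq.filter _ F; set F2 := seq.filter _ F.
have le2 : \sum_(M <- F2) \prod_(h <- M) f h <= P.
  apply: IHs => // [|M]; first exact: filter_uniq.
  rewrite mem_filter => /andP[gM MF] h hM; have := sF M MF h hM.
  by rewrite inE => /orP[/eqP hg|//]; rewrite -hg hM in gM.
pose F3 := [seq (M `\ g)%mset | M <- F1].
have F1E : \sum_(M <- F1) \prod_(h <- M) f h =
    f g * \sum_(M <- F3) \prod_(h <- M) f h.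
  rewrite big_map mulr_sumr big_seq [RHS]big_seq; apply: eq_bigr => M.
  by rewrite mem_filter => /andP[gM _]; exact: prod_msetB1.
have le3 : \sum_(M <- F3) \prod_(h <- M) f h <= (1 - f g)^-1 * P.
  apply: IHn.
  - rewrite map_inj_in_uniq ?filter_uniq // => M N.
    rewrite !mem_filter => /andP[gM _] /andP[gN _] /msetP MN.
    apply/msetP => h; have := MN h; rewrite !msetB1E.
    case: eqP => [->|]; last by rewrite !subn0.
    move: gM gN; rewrite -!mset_gt0.
    by case: (M g) (N g) => [|?] [|?] //; rewrite !subn1 /= => _ _ ->.
  - move=> _ /mapP[M + ->] h; rewrite mem_filter => /andP[_ MF].
    by rewrite in_msetB1 => /andP[_]; exact: sF.
  - move=> _ /mapP[M + ->]; rewrite mem_filter => /andP[_ MF].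
    by rewrite msetB1E eqxx leq_subLR add1n; exact: hn.
rewrite F1E.
apply: (le_trans (lerD (ler_wpM2l f0 le3) le2)).
have -> : f g * ((1 - f g)^-1 * P) + P = (1 - f g)^-1 * P; last by [].
by field; lra.
Qed.

End MultisetProducts.

(** * Separation of products versus gaps in the ordered list *)

Section Separation.
Context {R : realType}.
Implicit Types (G : set R) (delta a : R) (M N : multiset R).

Definition mprod M : R := \prod_(g <- M) g.

(** An order-free form of the gap condition: it refers to no enumeration, and for [delta > 0] it
    also rules out distinct multisets with equal products. *)
Definition separated delta G := forall M N, formal_products G M ->
  formal_products G N -> M <> N -> delta <= `|mprod M - mprod N|.

Lemma mprod_ge1 G M :
  (forall g, G g -> 1 < g) -> formal_products G M -> 1 <= mprod M.
Proof.
move=> G1 GM; rewrite /mprod big_seq.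
elim/big_ind: _ => // [x y x1 y1|g gM]; last by apply/ltW/G1/GM.
by rewrite -[1]mulr1 ler_pM.
Qed.

Lemma separated_of_gaps G (I : set nat) (b : nat -> R) delta :
  beurling_integers G I b ->
  (forall i, I i.+1 -> delta <= b i.+1 - b i) -> separated delta G.
Proof.
move=> [Idown bmono [e [[_ _ esurj] bE]]] gap M N.
move=> /esurj[i Ii <-] /esurj[j Ij <-] ij.
rewrite /mprod -!bE //; have {ij} : i != j by apply: contra_notN ij => /eqP->.
(* The gap from [k] to [k.+1] already suffices, as [b] does not decrease from there to [l]. *)
have key k l : (k < l)%N -> I k -> I l -> delta <= b l - b k.
  move=> kl Ik Il; have Ik1 := Idown _ _ kl Il.
  by have := gap _ Ik1; have := bmono _ _ Ik1 Il kl; lra.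
rewrite neq_ltn => /orP[] lt_ij; have := key _ _ lt_ij.
- by rewrite distrC => /(_ Ii Ij) /le_trans; apply; exact: ler_norm.
- by move=> /(_ Ij Ii) /le_trans; apply; exact: ler_norm.
Qed.

Lemma unbounded_increasing_enum (P : set nat) :
  (forall n, exists2 p, (n <= p)%N & P p) ->
  exists u : nat -> nat, [/\ forall n, P (u n), {homo u : m n / (m < n)%N} &
    forall p, P p -> exists n, u n = p].
Proof.
move=> Pinf; have /choice[nxt nxtP] n : exists q, [/\ (n <= q)%N, P q &
    forall p, (n <= p)%N -> P p -> (q <= p)%N].
  have ex : exists q, (n <= q)%N && `[<P q>].
    by have [p np Pp] := Pinf n; exists p; rewrite np; apply/asboolP.
  case: (ex_minnP ex) => q /andP[nq /asboolP Pq] qmin.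
  exists q; split=> // p np Pp.
  by apply: qmin; rewrite np; apply/asboolP.
pose u := fix u n := if n is n'.+1 then nxt (u n').+1 else nxt 0%N.
have uS n : (u n < u n.+1)%N by have [] := nxtP (u n).+1.
have u_ge n : (n <= u n)%N by elim: n => // n IHn; exact: leq_ltn_trans (uS n).
exists u; split=> [[|n]||p Pp].
- by have [] := nxtP 0%N.
- by have [] := nxtP (u n).+1.
- exact: (homo_ltn ltn_trans).
have ex : exists n, (p <= u n)%N by exists p.
case: (ex_minnP ex) => n pn nmin; exists n; apply/eqP; rewrite eqn_leq pn andbT.
case: n nmin pn => [|n] nmin _ /=; first by have [_ _] := nxtP 0%N; exact.
have [_ _] := nxtP (u n).+1; apply=> //; rewrite ltnNge; apply/negP => /nmin.
by rewrite ltnn.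
Qed.

Lemma expr_unbounded a (x : R) : 1 < a -> exists n, x <= a ^+ n.
Proof.
(* Bernoulli's inequality; the Archimedean property then supplies [n]. *)
move=> a1; have bern n : 1 + n%:R * (a - 1) <= a ^+ n.
  elim: n => [|n IHn]; first by rewrite expr0; lra.
  rewrite exprS -natr1; have : 0 <= n%:R :> R by [].
  move: IHn; set q := a ^+ n; set k := n%:R => IHn k0.
  have : 0 <= (a - 1) * (q - (1 + k * (a - 1))) by rewrite mulr_ge0; lra.
  by have : 0 <= k * (a - 1) ^+ 2; [rewrite mulr_ge0 ?sqr_ge0|lra].
have /archi_boundP : 0 <= `|x| / (a - 1) by rewrite divr_ge0 //; lra.
set n := Num.bound _; rewrite ltr_pdivrMr; last by lra.
by move=> xn; exists n; have := bern n; have := ler_norm x; lra.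
Qed.

(* Separation makes [M |-> floor (mprod M / delta)] an injection into nat that
   is strictly increasing in [mprod M], so listing its range in increasing
   order lists the products. *)
Lemma gaps_of_separated G g0 delta : (forall g, G g -> 1 < g) -> G g0 ->
  0 < delta -> separated delta G ->
  exists b, beurling_integers G [set: nat] b /\ forall i, delta <= b i.+1 - b i.
Proof.
move=> G1 Gg0 d0 sepG; pose r M := Num.truncn (mprod M / delta).
have rlt M N : formal_products G M -> formal_products G N -> (r M < r N)%N ->
    delta <= mprod N - mprod M.
  move=> GM GN MN; have lt_MN : mprod M < mprod N.
    rewrite ltNge; apply/negP => le_NM; move: MN.
    rewrite ltnNge => /negP; apply.
    by apply: le_truncn; rewrite ler_pM2r // invr_gt0.
  have : N <> M by move=> NM; move: MN; rewrite NM ltnn.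
  by move=> /(sepG _ _ GN GM); rewrite gtr0_norm // subr_gt0.
have rinj M N : formal_products G M -> formal_products G N ->
    r M = r N -> M = N.
  move=> GM GN rMN; apply: contrapT => /(sepG _ _ GM GN).
  have bound K : formal_products G K ->
      (r K)%:R * delta <= mprod K < ((r K)%:R + 1) * delta.
    move=> GK; have K0 : 0 <= mprod K / delta.
      by rewrite divr_ge0 ?(ltW d0) //; apply: le_trans (mprod_ge1 G1 GK).
    by have := truncn_itv K0; rewrite ler_pdivlMr // ltr_pdivrMr // -natr1.
  have := bound _ GM; have := bound _ GN; rewrite rMN => /andP[? ?] /andP[? ?].
  by rewrite leNgt => /negP; apply; rewrite ltr_norml; apply/andP; split; lra.
(* Powers of the single generator [g0] already make the range of [r] unbounded, so the list is
   indexed by all of [nat]. *)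
have [|u [uP ulu usurj]] := @unbounded_increasing_enum (r @` formal_products G).
  move=> n; have [k hk] := expr_unbounded (n%:R * delta) (G1 _ Gg0).
  have GK : formal_products G (msetn k g0).
    by move=> g; rewrite in_msetn => /andP[_ /eqP->].
  exists (r (msetn k g0)); last by exists (msetn k g0).
  rewrite /r /mprod prod_mset_nat -(natrK n (R := R)); apply: le_truncn.
  by rewrite ler_pdivlMr.
have /choice[e eP] n : exists M, formal_products G M /\ r M = u n.
  by have [M GM rM] := uP n; exists M.
have gap i j : (i < j)%N -> delta <= mprod (e j) - mprod (e i).
  move=> ij; have [Gi ri] := eP i; have [Gj rj] := eP j.
  by apply: rlt => //; rewrite ri rj; exact: ulu.
exists (fun n => mprod (e n)); split; last by move=> i; exact: gap.
split=> // [i j _ _|].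
  rewrite leq_eqVlt => /orP[/eqP-> //|/gap]; lra.
exists e; split=> //; split.
- by move=> i _; have [] := eP i.
- move=> i j _ _ eij; apply/eqP; have := eqxx (mprod (e i)); rewrite {2}eij.
  by case: (ltngtP i j) => // /gap; rewrite eij; lra.
- move=> M GM; have [|n un] := usurj (r M); first by exists M.
  by exists n => //; apply: rinj => //; have [] := eP n; rewrite ?un.
Qed.

Lemma mprod_adjoin a n M : mprod (msetn n a `+` M)%mset = a ^+ n * mprod M.
Proof. by rewrite /mprod prod_msetD prod_mset_nat. Qed.

(** As [a] is not in [G], a multiset is determined by its number of copies of [a] and the remaining
    part over [G]. Cancelling the smaller power of [a], a factor at least 1, can only shrink a
    distance. The exponent is [n.+1] because exponent 0 is covered by the separation of [G]. *)
Lemma separated_adjoin G a delta : ~ G a -> 1 < a ->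
  separated delta G ->
  separated delta (G `|` [set a]) <->
  (forall n M N, formal_products G M -> formal_products G N ->
    delta <= `|a ^+ n.+1 * mprod M - mprod N|).
Proof.
move=> Ga a1 sepG; split=> [sep n M N GM GN|sep].
  rewrite -mprod_adjoin; apply: sep.
  - by move=> g; rewrite in_msetD in_msetn => /orP[/eqP->|/GM]; [right|left].
  - by move=> g /GN; left.
  - move=> /msetP/(_ a); rewrite msetE2 msetnxx => Na; apply/Ga/GN.
    by rewrite in_mset -Na addSn.
have split_a M : formal_products (G `|` [set a]) M ->
    exists n M', formal_products G M' /\ M = (msetn n a `+` M')%mset.
  move=> GM; exists (M a), (M `\` msetn (M a) a)%mset; split.
    move=> g; rewrite in_msetB msetnE.
    case: eqP => [->|ga]; first by rewrite ltnn.
    by rewrite -in_mset => gM; case: (GM g gM).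
  apply/msetP => g; rewrite !msetE2 msetnE; case: eqP => [->|_].
    by rewrite subnn addn0.
  by rewrite subn0.
have main k l M N : formal_products G M -> formal_products G N -> (l <= k)%N ->
    (msetn k a `+` M)%mset <> (msetn l a `+` N)%mset ->
    delta <= `|a ^+ k * mprod M - a ^+ l * mprod N|.
  move=> GM GN lk MN.
  have -> : a ^+ k * mprod M - a ^+ l * mprod N =
      a ^+ l * (a ^+ (k - l) * mprod M - mprod N).
    by rewrite mulrBr mulrA -exprD subnKC.
  rewrite normrM ger0_norm; last by rewrite exprn_ge0 //; lra.
  apply: le_trans (_ : `|a ^+ (k - l) * mprod M - mprod N| <= _); last first.
    by rewrite ler_peMl // exprn_ege1 // ltW.
  case kl: (k - l)%N => [|n]; last exact: sep.
  rewrite expr0 mul1r; apply: sepG => // eMN; apply: MN; rewrite eMN.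
  by have -> : k = l by apply/eqP; rewrite eqn_leq lk -subn_eq0 kl.
move=> M N /split_a[k [M' [GM ->]]] /split_a[l [N' [GN ->]]] MN.
rewrite !mprod_adjoin.
have [lk|kl] := leqP l k; first exact: main.
by rewrite distrC; apply: main (ltnW kl) _ => // eNM; apply: MN.
Qed.
End Separation.

(** * Boundedness of the sum of inverse square roots of the products *)

Section Weights.
Context {R : realType}.
Implicit Types (G : set R) (C Y delta x : R).

Lemma inv_sqrt_mprod G (M : multiset R) : (forall g, G g -> 1 < g) ->
  formal_products G M ->
  (Num.sqrt (mprod M))^-1 = \prod_(g <- M) (Num.sqrt g)^-1.
Proof.
move=> G1 GM; rewrite prodfV; congr (_^-1).
suff [] : 0 <= mprod M /\ Num.sqrt (mprod M) = \prod_(g <- M) Num.sqrt g by [].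
rewrite /mprod !big_seq; elim/big_rec2: _ => [|g y1 y2 /GM/G1 g1 [y0 <-]].
  by rewrite sqrtr1.
by rewrite sqrtrM ?mulr_ge0 //; lra.
Qed.

Lemma inv_onem_le_expR q x : 0 <= x <= q -> q < 1 ->
  (1 - x)^-1 <= expR (x / (1 - q)).
Proof.
move=> /andP[x0 xq] q1; apply: le_trans (expR_ge1Dx _).
have -> : (1 - x)^-1 = 1 + x / (1 - x) by field; lra.
by rewrite lerD2l ler_wpM2l // lef_pV2 ?posrE; lra.
Qed.

(** By separation every generator is at distance at least [delta] from the empty product 1, so the
    Euler factors stay bounded; summability over [G] then bounds the Euler product, uniformly in the
    finite family [F]. *)
Lemma sum_inv_sqrt_mprod_le G delta : (forall g, G g -> 1 < g) ->
  0 < delta -> separated delta G ->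
  (\esum_(g in G) (1 / Num.sqrt g)%:E < +oo)%E ->
  exists C, forall F : seq (multiset R), uniq F ->
    (forall M, M \in F -> formal_products G M) ->
    \sum_(M <- F) (Num.sqrt (mprod M))^-1 <= C.
Proof.
move=> G1 d0 sepG Gfin.
have gd g : G g -> 1 + delta <= g.
  move=> Gg; have := @sepG [mset g]%mset mset0; rewrite /mprod.
  rewrite prod_mset_nat expr1 big_mset0 gtr0_norm ?subr_gt0 ?G1 //.
  rewrite lerBrDl; apply.
  - by move=> h; rewrite in_mset1 => /eqP->.
  - by move=> h; rewrite in_mset0.
  - by move=> /msetP/(_ g); rewrite msetnxx mset0E.
pose s0 := fine (\esum_(g in G) (1 / Num.sqrt g)%:E).
have sum_le (s : seq R) : uniq s -> (forall g, g \in s -> G g) ->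
    \sum_(g <- s) (Num.sqrt g)^-1 <= s0.
  move=> us sG; rewrite -lee_fin /s0 fineK; last first.
    rewrite ge0_fin_numE //; apply: esum_ge0 => g _.
    by rewrite lee_fin divr_ge0 ?sqrtr_ge0.
  apply: esum_ge; exists [set` s]; first by split=> //; exact: finite_seq.
  rewrite -fsbig_seq // -sumEFin; apply: lee_sum => g _.
  by rewrite div1r.
pose q : R := (Num.sqrt (1 + delta))^-1.
have q1 : q < 1.
  by rewrite invf_lt1 ?sqrtr_gt0 -?[ltLHS]sqrtr1 ?ltr_sqrt; lra.
have fq g : G g -> 0 <= (Num.sqrt g)^-1 <= q.
  move=> Gg; have g1 := G1 _ Gg; rewrite invr_ge0 sqrtr_ge0 /=.
  by rewrite lef_pV2 ?posrE ?sqrtr_gt0 ?ler_sqrt ?gd //; lra.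
(* [inv_onem_le_expR] bounds each Euler factor by an exponential, so their product is at most the
   exponential of a sum controlled by [s0]. *)
exists (expR (s0 / (1 - q))) => F uF FG.
pose s := undup (flatten [seq enum_mset M | M <- F]).
have sG g : g \in s -> G g.
  by rewrite mem_undup => /flattenP[_ /mapP[M MF ->]]; exact: FG.
have -> : \sum_(M <- F) (Num.sqrt (mprod M))^-1 =
    \sum_(M <- F) \prod_(g <- M) (Num.sqrt g)^-1.
  rewrite big_seq [RHS]big_seq; apply: eq_bigr => M /FG.
  exact: inv_sqrt_mprod.
apply: (le_trans (@sum_prod_mset_le _ _ (fun g => (Num.sqrt g)^-1) s _ _ uF _)).
- by move=> g /sG/fq/andP[-> /le_lt_trans->].
- move=> M MF g gM; rewrite mem_undup; apply/flattenP.
  exists (enum_mset M) => //.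
  exact: map_f.
apply: (@le_trans _ _ (\prod_(g <- s) expR ((Num.sqrt g)^-1 / (1 - q)))).
  rewrite [leLHS]big_seq [leRHS]big_seq; apply: ler_prod => g /sG/fq fg.
  rewrite inv_onem_le_expR // andbT invr_ge0 subr_ge0.
  by case/andP: fg => _ /le_trans; apply; exact: ltW.
rewrite -expR_sum ler_expR -mulr_suml ler_wpM2r ?sum_le ?undup_uniq //.
by rewrite invr_ge0; lra.
Qed.

End Weights.

(** * Measure of the set of [alpha] violating separation *)

Section Measure.
Context {R : realType}.
Implicit Types (C D K Y b c delta : R) (m : nat).

Local Notation mu := (@lebesgue_measure R).

(** Any point of [A] serves as centre of an interval of radius [D]; the factor 2 is the price for
    not locating the infimum of [A]. *)
Lemma lebesgue_measure_diameter (A : set R) D : measurable A -> 0 <= D ->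
  (forall x y, A x -> A y -> x <= y -> y - x <= D) -> (mu A <= (2 * D)%:E)%E.
Proof.
move=> mA D0 diam; have [[x0 Ax0]|A0] := pselect (exists x, A x); last first.
  have -> : A = set0 by rewrite -subset0 => x Ax; apply: A0; exists x.
  by rewrite measure0 lee_fin mulr_ge0.
apply: (@le_trans _ _ (mu `[x0 - D, x0 + D])).
  apply: le_measure; rewrite ?inE //= => x Ax; rewrite /= in_itv /=.
  by have [xx0|xx0] := leP x x0; [have := diam _ _ Ax Ax0 xx0|
    have := diam _ _ Ax0 Ax (ltW xx0)]; move=> ?; apply/andP; split; lra.
rewrite lebesgue_measure_itv /=.
case: ifP => _; last by rewrite lee_fin mulr_ge0.
by rewrite -EFinD lee_fin; lra.
Qed.

Lemma lebesgue_measure_bigcup_le (I : set nat) (F : nat -> set R)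
    (a : nat -> R) K C :
  (forall i, I i -> measurable (F i)) -> 0 <= K ->
  (forall i, I i -> (mu (F i) <= (K * a i)%:E)%E) ->
  (forall n, \sum_(i <- iota 0 n | i \in I) a i <= C) ->
  (mu (\bigcup_(i in I) F i) <= (K * C)%:E)%E.
Proof.
move=> mF K0 Fa aC; rewrite bigcup_mkcond; set F' := fun i => _.
have mF' i : measurable (F' i).
  by rewrite /F'; case: ifPn => // /set_mem; exact: mF.
have mUF' : measurable (\bigcup_i F' i) by exact: bigcup_measurable.
apply: (le_trans
  (@measure_sigma_subadditive _ _ _ mu _ _ mF' mUF' (@subset_refl _ _))).
apply: lime_le; first by apply: is_cvg_nneseries.
apply: nearW => n.
apply: (@le_trans _ _ (K * \sum_(i <- iota 0 n | i \in I) a i)%:E).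
  rewrite mulr_sumr [X in (_ <= X%:E)%E]big_mkcond -sumEFin /index_iota subn0.
  apply: lee_sum => i _; rewrite /F'.
  case: ifPn => [/set_mem|_]; first exact: Fa.
  by rewrite measure0.
by rewrite lee_fin ler_wpM2l.
Qed.

(** Here [b] and [c] stand for products over [G']; the exponent is shifted because power 0 is
    settled by the separation of [G']. *)
Definition close_powers delta b c m : set R :=
  [set alpha | `|alpha ^+ m.+1 * b - c| < delta].

Lemma measurable_close_powers delta b c m :
  measurable (close_powers delta b c m).
Proof.
have -> : close_powers delta b c m =
    (fun alpha => alpha ^+ m.+1 * b) @^-1` ball c delta.
  by apply/seteqP; split=> x; rewrite /close_powers /= /ball /= distrC.
apply: measurable_realfun.open_measurable.
apply: open_comp; last exact: ball_open.
by move=> x _; apply: cvgM; [exact: exprn_continuous|exact: cvg_cst].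
Qed.

(** The window is [[X, 2 * X]] with [X = Y ^+ 2], so that [X] has square root [Y]. The diameter is
    at most [8 * delta * X / c], and one of the two factors [Num.sqrt c] in its denominator is
    traded for [Y ^+ m.+1 * Num.sqrt b]. The resulting weight can be summed over [m], [b] and [c]
    separately. *)
Lemma close_powers_measure_le delta Y b c m :
  0 < delta -> 1 <= Y -> 3 * delta <= Y ^+ 2 -> 1 <= b ->
  (mu (close_powers delta b c m `&` `[(Y ^+ 2)%R, (2 * Y ^+ 2)%R]) <=
   (32 * delta * Y ^+ 2 * Y^-1 ^+ m.+1 *
    (Num.sqrt b)^-1 * (Num.sqrt c)^-1)%:E)%E.
Proof.
move=> d0 Y1 dY b1; set A := _ `&` _.
have mA : measurable A.
  by apply: measurableI => //; exact: measurable_close_powers.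
have Y0 : 0 < Y by lra.
have b0 : 0 < b by lra.
set B := _ * (Num.sqrt c)^-1.
have B0 : 0 <= B.
  by rewrite /B !mulr_ge0 ?invr_ge0 ?sqrtr_ge0 ?exprn_ge0 ?invr_ge0 //; lra.
have [[x0 [Ax0 Ix0]]|A0] := pselect (exists x, A x); last first.
  have -> : A = set0 by rewrite -subset0 => x Ax; apply: A0; exists x.
  by rewrite measure0 lee_fin.
set X := Y ^+ 2 in dY A mA B B0 Ix0 *.
have X1 : 1 <= X by rewrite /X exprn_ege1.
have cge : X ^+ m.+1 * b - delta <= c.
  move: Ix0; rewrite /= in_itv /= => /andP[Xx _].
  move: Ax0; rewrite /close_powers /= ltr_norml => /andP[_ hx].
  have : X ^+ m.+1 * b <= x0 ^+ m.+1 * b.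
    by rewrite ler_wpM2r ?lerXn2r ?nnegrE //; lra.
  by lra.
(* With [3 * delta <= X], the error [delta] in [cge] is at most a third of [X ^+ m.+1 * b]. *)
have XXb : X <= X ^+ m.+1 * b.
  rewrite exprS -mulrA ler_peMr //; first lra.
  by rewrite -[1]mulr1 ler_pM // exprn_ege1.
have c2d : 2 * delta <= c by lra.
have c0 : 0 < c by lra.
have c2 : X ^+ m.+1 * b <= 4 * c by lra.
have diam : forall x y, A x -> A y -> x <= y -> y - x <= 8 * delta * X / c.
  move=> x y [/= Ax Ix] [/= Ay Iy] xy.
  move: Ix Iy; rewrite /= !in_itv /= => /andP[Xx _] /andP[_ yX].
  move: Ax Ay; rewrite /close_powers /= !ltr_norml => /andP[x1 x2] /andP[y1 y2].
  have xym : x ^+ m <= y ^+ m by rewrite lerXn2r ?nnegrE //; lra.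
  have ym0 : 0 <= y ^+ m by rewrite exprn_ge0; lra.
  (* [y ^+ m.+1 - x ^+ m.+1] is at least [(y - x) * y ^+ m], because [x ^+ m <= y ^+ m]; both powers
     times [b] lie within [delta] of [c]. *)
  have e1 : (y - x) * (y ^+ m * b) <= 2 * delta.
    have : 0 <= x * (y ^+ m - x ^+ m) * b by rewrite !mulr_ge0 //; lra.
    by move: x1 x2 y1 y2; rewrite !exprS; lra.
  (* Here [y <= 2 * X], and [c2d] absorbs the error [delta] into [c / 2]. *)
  have e2 : c <= 4 * X * (y ^+ m * b).
    have : y * (y ^+ m * b) <= 2 * X * (y ^+ m * b).
      by rewrite ler_wpM2r // mulr_ge0 //; lra.
    by move: y1; rewrite exprS; lra.
  rewrite ler_pdivlMr //.
  have : (y - x) * c <= (y - x) * (4 * X * (y ^+ m * b)).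
    by rewrite ler_wpM2l //; lra.
  have : 4 * X * ((y - x) * (y ^+ m * b)) <= 4 * X * (2 * delta).
    by rewrite ler_wpM2l //; lra.
  by lra.
apply: (le_trans (lebesgue_measure_diameter mA _ diam)).
  by rewrite divr_ge0 ?mulr_ge0 //; lra.
rewrite lee_fin /B.
have sc0 : 0 < Num.sqrt c by rewrite sqrtr_gt0.
have sb0 : 0 < Num.sqrt b by rewrite sqrtr_gt0.
have Ym0 : 0 < Y ^+ m.+1 by rewrite exprn_gt0.
have root : Y ^+ m.+1 * Num.sqrt b <= 2 * Num.sqrt c.
  have -> : Y ^+ m.+1 * Num.sqrt b = Num.sqrt (X ^+ m.+1 * b).
    rewrite sqrtrM ?exprn_ge0 //; last lra.
    by rewrite /X -exprM mulnC exprM sqrtr_sqr ger0_norm // ltW.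
  have -> : 2 * Num.sqrt c = Num.sqrt (4 * c).
    by rewrite sqrtrM // (_ : 4 = 2 ^+ 2) ?sqrtr_sqr ?ger0_norm //; ring.
  by rewrite ler_sqrt //; lra.
have cV : c^-1 = (Num.sqrt c * Num.sqrt c)^-1.
  by rewrite -expr2 sqr_sqrtr // ltW.
rewrite cV exprVn.
have -> : 2 * (8 * delta * X / (Num.sqrt c * Num.sqrt c)) =
  16 * delta * X * (Num.sqrt c)^-1 * (Num.sqrt c)^-1 by field; lra.
have -> : 32 * delta * X / Y ^+ m.+1 / Num.sqrt b / Num.sqrt c =
  16 * delta * X * (2 / (Y ^+ m.+1 * Num.sqrt b)) * (Num.sqrt c)^-1.
  by field; lra.
rewrite ler_wpM2r ?invr_ge0 ?sqrtr_ge0 // ler_wpM2l ?mulr_ge0 //; try lra.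
by rewrite ler_pdivlMr ?mulr_gt0 // mulrC ler_pdivrMr.
Qed.

Lemma sum_inv_expr_le Y n : 2 <= Y ->
  \sum_(m <- iota 0 n) Y^-1 ^+ m.+1 <= 2 * Y^-1.
Proof.
move=> Y2; have r0 : 0 < Y^-1 by rewrite invr_gt0; lra.
have r2 : 2 * Y^-1 <= 1 by rewrite ler_pdivrMr; lra.
(* The subtracted term makes the claim inductive: the step needs exactly [2 * Y^-1 <= 1]. *)
suff : \sum_(m <- iota 0 n) Y^-1 ^+ m.+1 <= 2 * Y^-1 - 2 * Y^-1 ^+ n.+1.
  by have : 0 <= Y^-1 ^+ n.+1 by [rewrite exprn_ge0 // ltW]; lra.
elim: n => [|n IHn]; first by rewrite big_nil expr1; lra.
rewrite -addn1 iotaD big_cat /= big_seq1 add0n addn1.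
have : 0 <= Y^-1 ^+ n.+1 * (1 - 2 * Y^-1).
  by rewrite mulr_ge0 ?exprn_ge0 //; lra.
by move: IHn; rewrite [Y^-1 ^+ n.+2]exprSr; lra.
Qed.

(** The union bound factors into a geometric series in [m] and two sums bounded by [C]. The
    geometric series cancels one [Y] of [Y ^+ 2], so the bound is linear in [Y] while the window has
    length [Y ^+ 2]. *)
Lemma bad_measure_le (I : set nat) (v : nat -> R) C Y delta :
  (forall i, I i -> 1 <= v i) ->
  (forall n, \sum_(i <- iota 0 n | i \in I) (Num.sqrt (v i))^-1 <= C) ->
  0 < delta -> 2 <= Y -> 3 * delta <= Y ^+ 2 ->
  (mu (\bigcup_(m in [set: nat]) \bigcup_(i in I) \bigcup_(j in I)
     (close_powers delta (v i) (v j) m `&` `[(Y ^+ 2)%R, (2 * Y ^+ 2)%R])) <=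
   (64 * delta * C ^+ 2 * Y)%:E)%E.
Proof.
move=> v1 vC d0 Y2 dY.
have C0 : 0 <= C by have := vC 0%N; rewrite big_nil.
have Y0 : 0 < Y by lra.
pose K := 32 * delta * Y ^+ 2.
have K0 : 0 <= K by rewrite mulr_ge0 ?sqr_ge0 //; lra.
have Ym0 m : 0 <= Y^-1 ^+ m.+1 by rewrite exprn_ge0 // invr_ge0 ltW.
have mb : measurable `[Y ^+ 2, 2 * Y ^+ 2]%classic by [].
have -> : 64 * delta * C ^+ 2 * Y = K * C * C * (2 * Y^-1).
  by rewrite /K; field; lra.
have mA m i j :=
  measurableI _ _ (measurable_close_powers delta (v i) (v j) m) mb.
apply: (lebesgue_measure_bigcup_le (a := fun m => Y^-1 ^+ m.+1)); last 2 first.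
- move=> m _.
  rewrite [X in (_ <= X%:E)%E](_ : _ = K * Y^-1 ^+ m.+1 * C * C); last by ring.
  apply: (lebesgue_measure_bigcup_le (a := fun i => (Num.sqrt (v i))^-1)) => //.
  + by move=> i Ii; apply: bigcup_measurable => j _; exact: mA.
  + by rewrite mulr_ge0 // mulr_ge0.
  move=> i Ii.
  rewrite [X in (_ <= X%:E)%E](_ : _ =
    K * Y^-1 ^+ m.+1 * (Num.sqrt (v i))^-1 * C); last by ring.
  apply: (lebesgue_measure_bigcup_le (a := fun i => (Num.sqrt (v i))^-1)) => //.
  + by rewrite mulr_ge0 ?invr_ge0 ?sqrtr_ge0 // mulr_ge0.
  by move=> j Ij; apply: close_powers_measure_le; rewrite ?v1 //; lra.
- move=> n; rewrite (eq_bigl xpredT) ?sum_inv_expr_le // => i.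
  by rewrite mem_set.
- move=> m _; apply: bigcup_measurable => i _.
  by apply: bigcup_measurable => j _; exact: mA.
by rewrite mulr_ge0 // mulr_ge0.
Qed.

Lemma countable_int_num : countable [set x : R | x \is a Num.int].
Proof.
apply: (@sub_countable _ _ _ (\bigcup_(z in [set: int]) [set z%:~R])).
  apply: subset_card_le => x /= /intrP[z ->]; by exists z.
by apply: bigcup_countable => // z _; exact: countable1.
Qed.

End Measure.

(** * Existence and positive measure of the admissible [alpha] *)

Theorem theorem3 (R : realType) (G' : set R) (I' : set nat) (b' : nat -> R)
    (delta : R)
    (hG' : forall g : R, G' g -> 1 < g)
    (hsum : (\esum_(g in G') (1 / Num.sqrt g)%:E < +oo)%E)
    (hb' : beurling_integers G' I' b')
    (hdelta : 0 < delta)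
    (hgap : forall i : nat, I' i.+1 -> delta <= b' i.+1 - b' i) :
  let S : set R := [set alpha : R |
    [/\ alpha \isn't a Num.int, 1 < alpha &
      exists b : nat -> R,
        beurling_integers (G' `|` [set alpha]) [set: nat] b /\
        forall i : nat, delta <= b i.+1 - b i]] in
  (exists alpha : R, S alpha) /\
  measurable S /\
  (0 < lebesgue_measure S)%E.
Proof.
move=> S.
have [_ _ [e [[eG einj esurj] _]]] := hb'.
have sepG := separated_of_gaps hb' hgap.
pose v i := mprod (e i).
have v1 i : I' i -> 1 <= v i by move=> /eG; exact: mprod_ge1.
have [C hC] := sum_inv_sqrt_mprod_le hG' hdelta sepG hsum.
have vC n : \sum_(i <- iota 0 n | i \in I') (Num.sqrt (v i))^-1 <= C.
  rewrite -big_filter -(big_map e predT (fun M => (Num.sqrt (mprod M))^-1)).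
  apply: hC => [|M /mapP[i]].
    rewrite map_inj_in_uniq ?filter_uniq ?iota_uniq // => i j.
    by rewrite !mem_filter => /andP[iI _] /andP[jI _]; exact: einj.
  by rewrite mem_filter => /andP[/set_mem iI _] ->; exact: eG.
(* The enumeration [e] of the products turns the violations into a countable union, hence a
   measurable set. *)
pose bad := \bigcup_(m in [set: nat]) \bigcup_(i in I') \bigcup_(j in I')
  close_powers delta (v i) (v j) m.
have badP alpha : ~ bad alpha <-> forall m M N, formal_products G' M ->
    formal_products G' N -> delta <= `|alpha ^+ m.+1 * mprod M - mprod N|.
  split=> [nbad m M N /esurj[i Ii <-] /esurj[j Ij <-]|far [m _ [i Ii [j Ij]]]].
    rewrite leNgt; apply/negP => close; apply: nbad.
    by exists m => //; exists i => //; exists j.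
  by rewrite /close_powers /= ltNge far //; exact: eG.
have mbad : measurable bad.
  apply: bigcup_measurable => m _; apply: bigcup_measurable => i _.
  by apply: bigcup_measurable => j _; exact: measurable_close_powers.
(* With exponent 1, [b = 1] and [c = g], the choice [alpha = g] gives distance 0. Avoiding [bad]
   thus implies avoiding [G'], as [separated_adjoin] requires. *)
have G'bad : G' `<=` bad.
  move=> g Gg; apply: contrapT => /badP/(_ 0%N mset0 [mset g]%mset).
  rewrite /mprod big_mset0 prod_mset_nat !expr1 mulr1 subrr normr0 leNgt hdelta.
  move=> far; suff : ~~ true by [].
  by apply: far => h; rewrite ?in_mset0 // in_mset1 => /eqP->.
pose ints := [set x : R | x \is a Num.int].
have cG' : countable G'.
  apply: (@sub_countable _ _ _ (\bigcup_(i in [set: nat]) [set v i])).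
    apply: subset_card_le => g Gg; have [|i Ii ei] := esurj [mset g]%mset.
      by move=> h; rewrite in_mset1 => /eqP->.
    by exists i => //=; rewrite /v ei /mprod prod_mset_nat.
  by apply: bigcup_countable => // i _; exact: countable1.
(* An alpha in G' satisfies G' `|` [set alpha] = G': it may lie in S although it
   is bad, which is why S `&` G' is kept apart. *)
have SE : S = ((~` bad `&` `]1, +oo[) `&` ~` ints) `|` (S `&` G').
  apply/seteqP; split=> x.
    have [Gx|Gx] := pselect (G' x); first by right.
    move=> [xint x1 [b [hb gap]]]; left; split; last exact/negP.
    split; last by rewrite /= in_itv /= x1.
    apply/badP/(separated_adjoin Gx x1 sepG).
    by apply: separated_of_gaps hb _ => i _; exact: gap.
  move=> [[[nbad]]|[]//]; rewrite /= in_itv /= andbT => x1 /negP xint.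
  split=> //; have Gx : ~ G' x by move=> /G'bad.
  apply: (@gaps_of_separated _ _ x) => //; [|by right|].
    by move=> g [/hG'|->].
  by apply/(separated_adjoin Gx x1 sepG)/badP.
have mints : measurable ints.
  by apply: countable_measurable => //; exact: countable_int_num.
have mS : measurable S.
  rewrite SE; apply: measurableU.
    by do 2 ?apply: measurableI => //; exact: measurableC.
  apply: countable_measurable => //.
  by apply: sub_countable cG'; apply: subset_card_le => x [].
have Spos : (0 < lebesgue_measure S)%E.
  rewrite lt0e measure_ge0 andbT; apply/eqP => S0.
  (* Chosen so that [Y ^+ 2] equals the bound of [bad_measure_le] plus the positive term
     [Y * (2 + 3 * delta)]; the first two summands also give the size conditions on [Y]. *)
  pose Y := 2 + 3 * delta + 64 * delta * C ^+ 2.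
  have dC : 0 <= delta * C ^+ 2 by rewrite mulr_ge0 ?sqr_ge0 // ltW.
  have Y2 : 2 <= Y by rewrite /Y; lra.
  have YY : Y <= Y ^+ 2 by rewrite expr2 ler_peMr //; lra.
  have dY : 3 * delta <= Y ^+ 2 by apply: le_trans YY; rewrite /Y; lra.
  have := bad_measure_le v1 vC hdelta Y2 dY; set badY := bigcup _ _ => badYle.
  pose E : set R := `[Y ^+ 2, 2 * Y ^+ 2]%classic.
  have mE : measurable E by exact: measurable_itv.
  have mbadY : measurable badY.
    apply: bigcup_measurable => m _; apply: bigcup_measurable => i _.
    apply: bigcup_measurable => j _; apply: measurableI => //.
    exact: measurable_close_powers.
  (* If [S] is null, this covering bounds the length [Y ^+ 2] of [E] by the measure of [badY], the
     integers being null. *)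
  have Esub : E `<=` (S `|` badY) `|` ints.
    move=> x Ex; have [|xint] := pselect (ints x); first by right.
    left; have [[m mT [i Ii [j Ij close]]]|nbad] := pselect (bad x).
      by right; exists m => //; exists i => //; exists j.
    left; rewrite SE; left; split=> //; split=> //.
    move: Ex; rewrite /E /= !in_itv /= andbT => /andP[YX _].
    by apply: lt_le_trans YX; lra.
  have : (lebesgue_measure E <= (64 * delta * C ^+ 2 * Y)%:E)%E.
    have mSb : measurable (S `|` badY) by exact: measurableU.
    apply: (@le_trans _ _ (lebesgue_measure ((S `|` badY) `|` ints))).
      by apply: le_measure => //; rewrite inE //; exact: measurableU.
    apply: (le_trans (@measureU2 _ _ _ lebesgue_measure _ _ mSb mints)).
    rewrite [X in (_ + X)%E]countable_lebesgue_measure0 ?adde0; last first.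
      exact: countable_int_num.
    apply: (le_trans (@measureU2 _ _ _ lebesgue_measure _ _ mS mbadY)).
    by rewrite [X in (X + _)%E]S0 add0e.
  rewrite /E lebesgue_measure_itv /= lte_fin -EFinD.
  have Y20 : 0 < Y ^+ 2 by rewrite exprn_gt0 //; lra.
  rewrite ifT; last by lra.
  rewrite lee_fin leNgt => /negP; apply.
  have : 0 < Y * (2 + 3 * delta) by rewrite mulr_gt0 //; lra.
  have : Y ^+ 2 = Y * (2 + 3 * delta) + 64 * delta * C ^+ 2 * Y.
    by rewrite /Y; ring.
  by lra.
split; last by split.
apply: contrapT => noS; suff S0 : S = set0 by rewrite S0 measure0 ltxx in Spos.
by rewrite -subset0 => x Sx; apply: noS; exists x.
Qed.
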